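(* Fix $d,k\in\mathbb N$ and let $A\in\mathbb R^{d^k\times d^k}$ be positive semidefinite. Let $x=x_1\otimes\cdots\otimes x_k$, where $x_1,\dots,x_k\in\mathbb R^d$ are independent and each is either a Rademacher vector or a $\mathcal N(0,I_d)$ Gaussian vector. Then $\operatorname{Var}[x^\top Ax]\le(3^k\operatorname{tr}(A))^2$.
   Context: A Rademacher vector has iid entries uniform on $\{\pm1\}$; $\otimes$ is the Kronecker product. *)

(* Defs.v *)
From HB Require Import structures.
From mathcomp Require Import all_boot all_order all_algebra.
From mathcomp Require Import mxtens.
From mathcomp Require Import all_classical all_reals all_analysis.
Set Implicit Arguments. Unset Strict Implicit. Unset Printing Implicit Defensive.
Import Order.TTheory GRing.Theory Num.Theory.
Local Open Scope classical_set_scope.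
Local Open Scope ring_scope.

(* Iterated Kronecker product x_0 ⊗ x_1 ⊗ ... ⊗ x_(k-1) of column vectors,
   using MathComp's Kronecker product [tensmx] (standard index order). *)
Fixpoint kronv (R : pzRingType) (d k : nat) : ('I_k -> 'cV[R]_d) -> 'cV[R]_(d ^ k) :=
  match k return ('I_k -> 'cV[R]_d) -> 'cV[R]_(d ^ k) with
  | 0 => fun _ => castmx (esym (expn0 d), erefl 1%N) (1%:M : 'M[R]_1)
  | k'.+1 => fun x =>
      castmx (esym (expnS d k'), muln1 1)
             (tensmx (x ord0) (kronv (fun i : 'I_k' => x (lift ord0 i))))
  end.

Definition psd (R : realDomainType) (n : nat) (A : 'M[R]_n) : Prop :=
  A^T = A /\ forall v : 'cV[R]_n, 0 <= (v^T *m A *m v) 0 0.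

Definition mutually_independent (R : realType) (dT : measure_display)
    (T : measurableType dT) (P : probability T R) (I : finType) (Y : I -> T -> R) : Prop :=
  forall B : I -> set R, (forall i, measurable (B i)) ->
    P (\bigcap_(i in [set: I]) (Y i @^-1` B i)) = (\prod_(i : I) P (Y i @^-1` B i))%E.

Definition rademacher (R : realType) (dT : measure_display)
    (T : measurableType dT) (P : probability T R) (Y : T -> R) : Prop :=
  P (Y @^-1` [set 1]) = (1 / 2)%:E /\ P (Y @^-1` [set -1]) = (1 / 2)%:E.

Definition std_gaussian (R : realType) (dT : measure_display)
    (T : measurableType dT) (P : probability T R) (Y : T -> R) : Prop :=
  forall B : set R, measurable B -> P (Y @^-1` B) = normal_prob 0 1 B.

(* Main.v *)
(* The variance is at most E[(x^T A x)^2], which expands into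
   sum_{p,q,r,s} A_pq A_rs E[x_p x_q x_r x_s].  The mixed moments are nonnegative
   and factor over the k tensor components; in each component such a moment
   vanishes unless p, q, r, s match in pairs, and is at most 3 times the number of
   ways to pair them.  Positive semidefiniteness gives |A_pq| <= a_p a_q with
   a_p = sqrt A_pp, so everything is dominated by a sum with nonnegative terms,
   which Cauchy-Schwarz, applied one component at a time, bounds by
   9^k (sum_p a_p^2)^2 = (3^k tr A)^2. *)

Require Import Defs.
From HB Require Import structures.
From mathcomp Require Import all_boot all_order all_algebra.
From mathcomp Require Import mxtens.
From mathcomp Require Import all_classical all_reals all_analysis.
From mathcomp Require Import measurable_realfun ring lra.
Import Order.TTheory GRing.Theory Num.Theory.
Local Open Scope classical_set_scope.
Local Open Scope ring_scope.

(** Independence is given for events only, so the factorisation of mixed moments has to be earned: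
    it passes from indicators to nonnegative functions and then to integrable ones. Rademacher and
    Gaussian coordinates reach the combinatorics through one interface, [tame_moments]. The Gaussian
    bounds come from E[exp(c Y^2)], a mere rescaling of the density, so no integration by parts
    occurs; the loss is absorbed by the slack in the constants. Of the factor 9 per component, one 3
    is the moment bound and the other is the number of pairings of four indices. The final induction
    runs over four unrelated vectors although it is applied to a single one: fixing the first digits
    of p, q, r, s cuts out four different slices, so a statement about one vector would not be
    inductive. *)

(** * Image of a weighted measure under a map *)

Section weighted_integral.
Context {d1 d2 : measure_display} {T : measurableType d1} {U : measurableType d2}.
Context {R : realType} (m : {measure set T -> \bar R}) (nu : {measure set U -> \bar R}).
Variables (Y : T -> U) (G : T -> R) (c : R).
Hypotheses (mY : measurable_fun setT Y) (mG : measurable_fun setT G).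
Hypotheses (G0 : forall t, 0 <= G t) (c0 : 0 <= c).
Hypothesis weighted_indic : forall B, measurable B ->
  (\int[m]_t (G t * \1_B (Y t))%:E = c%:E * nu B)%E.

Import HBNNSimple.

Lemma integral_weighted_nnsfun (h : {nnsfun U >-> R}) :
  (\int[m]_t (G t * h (Y t))%:E = \int[nu]_u (c * h u)%:E)%E.
Proof.
have mh k : measurable_fun setT (fun t => \1_(h @^-1` [set k]) (Y t) : R).
  by apply: measurableT_comp => //; exact: measurable_indic.
have k1_ge0 k (u : U) : 0 <= k * \1_(h @^-1` [set k]) u :> R.
  by have := nnfun_muleindic_ge0 h k u; rewrite lee_fin.
under eq_integral do rewrite fimfunE mulr_fsumr -fsumEFin//.
rewrite ge0_integral_fsum//; last 2 first.
- by move=> k; apply/measurable_EFinP; do 2 apply: measurable_funM => //.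
- by move=> k t _; rewrite lee_fin mulr_ge0.
under [RHS]eq_integral do rewrite fimfunE mulr_fsumr -fsumEFin//.
rewrite ge0_integral_fsum//; last 2 first.
- move=> k; apply/measurable_EFinP; do 2 apply: measurable_funM => //.
- by move=> k t _; rewrite lee_fin mulr_ge0.
apply: eq_fsbigr => k; rewrite inE => -[u _ <-{k}].
have hu0 : 0 <= h u by [].
transitivity ((h u)%:E * \int[m]_t (G t * \1_(h @^-1` [set h u]) (Y t))%:E)%E.
  rewrite -ge0_integralZl_EFin//.
  - by apply: eq_integral => t _; rewrite -EFinM mulrCA.
  - by move=> t _; rewrite lee_fin mulr_ge0.
  - by apply/measurable_EFinP; apply: measurable_funM.
rewrite weighted_indic//.
transitivity ((h u * c)%:E * \int[nu]_t (\1_(h @^-1` [set h u]) t)%:E)%E.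
  by rewrite integral_indic// setIT EFinM muleA.
rewrite -ge0_integralZl_EFin//.
- by apply: eq_integral => t _; rewrite -EFinM mulrCA mulrA.
- exact/measurable_EFinP/measurable_indic.
- by rewrite mulr_ge0.
Qed.

(** [weighted_indic] says that the measure with density [G], pushed along [Y], is [c] times [nu];
    monotone convergence extends this from simple functions. It serves with [G] a product of other
    factors (independence) and with [G] a probability density (Gaussian law). *)
Lemma ge0_integral_weighted (f : U -> R) : measurable_fun setT f ->
  (forall u, 0 <= f u) ->
  (\int[m]_t (G t * f (Y t))%:E = c%:E * \int[nu]_u (f u)%:E)%E.
Proof.
move=> mf f0.
have mfE : measurable_fun setT (EFin \o f) by exact/measurable_EFinP.
pose f_ := nnsfun_approx measurableT mfE.
have cvgf (a : R) u : ((a * f_ n u)%:E @[n --> \oo] --> (a * f u)%:E)%E.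
  under eq_fun do rewrite EFinM.
  rewrite EFinM; apply: cvgeZl => //.
  by apply: (cvg_nnsfun_approx measurableT mfE) => // x _; rewrite /= lee_fin.
have ndf (a : R) u : 0 <= a -> {homo (fun n => (a * f_ n u)%:E)
    : n n' / (n <= n')%N >-> (n <= n')%E}.
  move=> a0 n n' nn'; rewrite lee_fin ler_wpM2l//.
  exact/lefP/nd_nnsfun_approx.
rewrite -ge0_integralZl_EFin//; last by move=> u _; rewrite lee_fin.
under [RHS]eq_integral do rewrite -EFinM.
transitivity (limn (fun n => \int[m]_t (G t * f_ n (Y t))%:E)%E).
  rewrite -monotone_convergence//.
  - by apply: eq_integral => t _; apply/esym/cvg_lim.
  - move=> n; apply/measurable_EFinP; apply: measurable_funM => //.
    exact: measurableT_comp.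
  - by move=> n t _; rewrite lee_fin mulr_ge0.
  - by move=> t _; exact: ndf.
transitivity (limn (fun n => \int[nu]_u (c * f_ n u)%:E)%E).
  by congr (limn _); apply/funext => n; exact: integral_weighted_nnsfun.
rewrite -monotone_convergence//.
- by apply: eq_integral => t _; apply/cvg_lim.
- by move=> n; apply/measurable_EFinP; apply: measurable_funM.
- by move=> n t _; rewrite lee_fin mulr_ge0.
- by move=> t _; exact: ndf.
Qed.

End weighted_integral.

(** * Expectations of products of independent variables *)

Section independence.
Context {R : realType} {dT : measure_display} {T : measurableType dT}.
Context (P : probability T R) {I : finType} (Y : I -> T -> R).
Hypothesis mY : forall i, measurable_fun setT (Y i).
Hypothesis indepY : mutually_independent P Y.

Lemma integral_prod_indic (B : I -> set R) : (forall i, measurable (B i)) ->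
  (\int[P]_t (\prod_i \1_(B i) (Y i t))%:E = \prod_i P (Y i @^-1` B i))%E.
Proof.
move=> mB; rewrite -indepY//.
have mYB i : measurable (Y i @^-1` B i) by rewrite -[_ @^-1` _]setTI; exact: mY.
rewrite -[RHS](_ : P (\bigcap_(i in [set: I]) Y i @^-1` B i `&` setT) = _);
  last by rewrite setIT.
rewrite -integral_indic//; last first.
  exact: fin_bigcap_measurable.
apply: eq_integral => t _; congr EFin.
rewrite [RHS]indicE; case: (boolP (t \in _)) => [/set_mem tB|/negP tB'].
  by rewrite big1// => i _; rewrite indicE mem_set//; exact: tB.
have /existsNP[i tBi] : ~ forall i, B i (Y i t).
  by move=> tB; apply: tB'; apply/mem_set => i _; exact: tB.
by rewrite (bigD1 i)//= indicE memNset// mul0r.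
Qed.

(* The index [i] in [s] carries an arbitrary nonnegative function and the other
   ones an indicator; each step of the induction upgrades one indicator. *)
Lemma ge0_integral_prod_seq (s : seq I) (f : I -> R -> R) (e : I -> R) :
  (forall i, measurable_fun setT (f i)) -> (forall i x, 0 <= f i x) ->
  (forall i, (\int[P]_t (f i (Y i t))%:E = (e i)%:E)%E) ->
  (forall i, i \notin s -> exists2 B, measurable B & f i = \1_B) ->
  (\int[P]_t (\prod_i f i (Y i t))%:E = (\prod_i e i)%:E)%E.
Proof.
elim: s f e => [|j s IHs] f e mf f0 fe fB.
  have /choice[B mfB] : forall i, exists B, measurable B /\ f i = \1_B.
    by move=> i; have [//|B mB ->] := fB i; exists B.
  have fE i : f i = \1_(B i) by have [] := mfB i.
  have mB i : measurable (B i) by have [] := mfB i.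
  under eq_integral do under eq_bigr do rewrite fE.
  rewrite integral_prod_indic// -prodEFin.
  apply: eq_bigr => i _; rewrite -fe fE.
  have mYB : measurable (Y i @^-1` B i) by rewrite -[_ @^-1` _]setTI; exact: mY.
  by rewrite -[in LHS](setIT (Y i @^-1` _)) -integral_indic.
have e_ge0 i : 0 <= e i.
  by rewrite -lee_fin -fe; apply: integral_ge0 => t _; rewrite lee_fin.
have mfY i : measurable_fun setT (fun t => f i (Y i t)) by exact: measurableT_comp.
pose Yj : {mfun T >-> R} := HB.pack (Y j) (isMeasurableFun.Build _ _ _ _ _ (mY j)).
(* The factors other than [j] become the weight, and [c] is their expected mean. The hypothesis on
   indicators is then exactly the induction hypothesis for the family whose factor at [j] is an
   indicator. *)
pose G t := \prod_(i | i != j) f i (Y i t).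
pose c := \prod_(i | i != j) e i.
under eq_integral do rewrite (bigD1 j)//= mulrC -/(G _).
rewrite [X in (X%:E)%E](bigD1 j)//= -/c.
rewrite (@ge0_integral_weighted _ _ _ _ _ P (pushforward P Yj) Yj G c)//.
- rewrite ge0_integral_pushforward//; last 2 first.
    exact/measurable_EFinP.
    by move=> x _; rewrite lee_fin.
  by rewrite preimage_setT [X in (_ * X)%E]fe -EFinM mulrC.
- rewrite /G; under eq_fun do rewrite -big_filter.
  by apply: measurable_prod => i _; exact: mfY.
- by move=> t; apply: prodr_ge0 => i _; exact: f0.
- by apply: prodr_ge0.
- move=> B mB.
  have mYB : measurable (Y j @^-1` B) by rewrite -[_ @^-1` _]setTI; exact: mY.
  have PB : P (Y j @^-1` B) \is a fin_num by rewrite fin_num_measure.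
  pose f' i := if i == j then \1_B else f i.
  pose e' i := if i == j then fine (P (Y j @^-1` B)) else e i.
  have e'E : \prod_i e' i = c * fine (P (Y j @^-1` B)).
    rewrite (bigD1 j)//= {1}/e' eqxx mulrC; congr (_ * _).
    by apply: eq_bigr => i /negbTE ij; rewrite /e' ij.
  have := IHs f' e'; rewrite e'E EFinM fineK// => <-.
  + apply: eq_integral => t _; rewrite [in RHS](bigD1 j)//= mulrC /f' eqxx.
    congr (_ * _)%:E.
    by apply: eq_bigr => i /negbTE ->.
  + by move=> i; rewrite /f'; case: ifP.
  + by move=> i x; rewrite /f'; case: ifP.
  + move=> i; rewrite /f' /e'; case: eqP => // ->; rewrite fineK//.
    by rewrite -[in RHS](setIT (Y j @^-1` _)) -integral_indic.
  + move=> i si; rewrite /f'; case: eqP => [_|/eqP ij]; first by exists B.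
    by apply: fB; rewrite inE negb_or ij.
Qed.

(** Only the indices in [s] may carry signed functions. Splitting the factor at [j] into positive
    and negative parts gives two products with one sign-changing index fewer, and linearity
    recombines them; integrability is carried along to justify the subtraction. *)
Lemma integral_prod_seq (s : seq I) (f : I -> R -> R) (e : I -> R) :
  (forall i, measurable_fun setT (f i)) ->
  (forall i, P.-integrable setT (fun t => (f i (Y i t))%:E)) ->
  (forall i, (\int[P]_t (f i (Y i t))%:E = (e i)%:E)%E) ->
  (forall i, i \notin s -> forall x, 0 <= f i x) ->
  P.-integrable setT (fun t => (\prod_i f i (Y i t))%:E) /\
  (\int[P]_t (\prod_i f i (Y i t))%:E = (\prod_i e i)%:E)%E.
Proof.
elim: s f e => [|j s IHs] f e mf fint fe f0.
  have f_ge0 i x : 0 <= f i x by exact: f0.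
  have fprod : (\int[P]_t (\prod_i f i (Y i t))%:E = (\prod_i e i)%:E)%E.
    apply: (@ge0_integral_prod_seq (enum I)) => // i.
    by rewrite mem_enum.
  split=> //; apply/integrableP; split.
    apply/measurable_EFinP; apply: measurable_prod => i _.
    exact: measurableT_comp.
  under eq_integral.
    move=> t _; rewrite gee0_abs; last by rewrite lee_fin prodr_ge0.
    over.
  by rewrite fprod ltry.
have mfY i : measurable_fun setT (fun t => f i (Y i t)) by exact: measurableT_comp.
pose fsg (b : bool) := if b then ((f j)^\+)%R else ((f j)^\-)%R.
pose f' b i := if i == j then fsg b else f i.
pose esg b := fine (\int[P]_t (fsg b (Y j t))%:E)%E.
pose e' b i := if i == j then esg b else e i.
have fsgint b : P.-integrable setT (fun t => (fsg b (Y j t))%:E).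
  case: b; [have := integrable_funrpos measurableT (fint j)|
            have := integrable_funrneg measurableT (fint j)]; exact.
have esgE b : (\int[P]_t (fsg b (Y j t))%:E = (esg b)%:E)%E.
  by rewrite fineK// integrable_fin_num.
have IH b : P.-integrable setT (fun t => (\prod_i f' b i (Y i t))%:E) /\
  (\int[P]_t (\prod_i f' b i (Y i t))%:E = (\prod_i e' b i)%:E)%E.
  apply: IHs.
  - move=> i; rewrite /f'; case: ifP => // _; rewrite /fsg; case: b.
      exact: measurable_funrpos.
    exact: measurable_funrneg.
  - by move=> i; rewrite /f'; case: eqP => // ->.
  - by move=> i; rewrite /f' /e'; case: eqP => // ->.
  - move=> i si x; rewrite /f'; case: eqP => [_|/eqP ij].
      by rewrite /fsg; case: b.
    by apply: f0; rewrite inE negb_or ij.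
have f'E b t : \prod_i f' b i (Y i t) = fsg b (Y j t) * \prod_(i | i != j) f i (Y i t).
  rewrite (bigD1 j)//= {1}/f' eqxx; congr (_ * _).
  by apply: eq_bigr => i /negbTE ij; rewrite /f' ij.
have e'E b : \prod_i e' b i = esg b * \prod_(i | i != j) e i.
  rewrite (bigD1 j)//= {1}/e' eqxx; congr (_ * _).
  by apply: eq_bigr => i /negbTE ij; rewrite /e' ij.
have fjE x : f j x = fsg true x - fsg false x by rewrite -[in LHS](funrposBneg (f j)).
have fE t : (\prod_i f i (Y i t))%:E =
    ((\prod_i f' true i (Y i t))%:E - (\prod_i f' false i (Y i t))%:E)%E.
  by rewrite -EFinB !f'E -mulrBl -fjE (bigD1 j).
have ejE : e j = esg true - esg false.
  apply: EFin_inj; rewrite -fe EFinB -!esgE -integralB//.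
  by apply: eq_integral => t _; rewrite fjE EFinB.
have [intp Ep] := IH true; have [intn En] := IH false.
split.
  under eq_fun do rewrite fE.
  exact: integrableB.
under eq_integral do rewrite fE.
by rewrite integralB// Ep En -EFinB !e'E -mulrBl -ejE [in RHS](bigD1 j).
Qed.

Lemma integral_prod (f : I -> R -> R) (e : I -> R) :
  (forall i, measurable_fun setT (f i)) ->
  (forall i, P.-integrable setT (fun t => (f i (Y i t))%:E)) ->
  (forall i, (\int[P]_t (f i (Y i t))%:E = (e i)%:E)%E) ->
  P.-integrable setT (fun t => (\prod_i f i (Y i t))%:E) /\
  (\int[P]_t (\prod_i f i (Y i t))%:E = (\prod_i e i)%:E)%E.
Proof.
by move=> mf fint fe; apply: (@integral_prod_seq (enum I)) => // i; rewrite mem_enum.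
Qed.

End independence.

(** * Gaussian laws: symmetry and exponential moments of the square *)

(** Since exp(u) >= (1 + u/8)^8, whose quadratic coefficient is 28/64 = 7/16, and exp(-u) >= 1 - u,
    the linear terms cancel. With u = c Y^2 this bounds Y^4 by exponential moments. *)
Lemma expRD_oppr_ge (R : realType) (u : R) : 0 <= u ->
  2 + 7 / 16 * u ^+ 2 <= expR u + expR (- u).
Proof.
move=> u0; have e1 : 1 - u <= expR (- u) by exact: expR_ge1Dx.
pose w := u / 8; have w0 : 0 <= w by rewrite /w; lra.
have uE : u = 8 * w by rewrite /w; lra.
have e8 : (1 + w) ^+ 8 <= expR u.
  rewrite uE expRM_natl lerXn2r ?nnegrE ?expR_ge0 ?expR_ge1Dx//.
  by rewrite addr_ge0.
have : 1 + 8 * w + 28 * w ^+ 2 <= (1 + w) ^+ 8.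
  rewrite -subr_ge0 (_ : _ - _ = w ^+ 3 * (56 + 70 * w + 56 * w ^+ 2
    + 28 * w ^+ 3 + 8 * w ^+ 4 + w ^+ 5)); last by ring.
  by rewrite mulr_ge0 ?exprn_ge0// !addr_ge0 ?mulr_ge0 ?exprn_ge0.
move: e1 e8; rewrite uE; set a := expR _; set b := expR _; lra.
Qed.

Section lebesgue_reflection.
Context {R : realType}.
Local Notation mu := (@lebesgue_measure R).

Lemma ge0_integral_lebesgueN (g : R -> R) : measurable_fun setT g ->
  (forall x, 0 <= g x) ->
  (\int[mu]_x (g x)%:E = \int[mu]_x (g (- x))%:E)%E.
Proof.
move=> mg g0.
pose opp : {mfun measurableTypeR R >-> measurableTypeR R} :=
  HB.pack (-%R : R -> R) (isMeasurableFun.Build _ _ (measurableTypeR R)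
    (measurableTypeR R) (-%R : R -> R) (@oppr_measurable R setT)).
transitivity (\int[pushforward mu opp]_x (g x)%:E)%E.
  by apply: eq_measure_integral => A mA _; rewrite -[LHS]lebesgue_measureN.
rewrite ge0_integral_pushforward//.
- exact/measurable_EFinP.
- by move=> x _; rewrite lee_fin.
Qed.

End lebesgue_reflection.

Section gaussian.
Context {R : realType} {dT : measure_display} {T : measurableType dT}.
Context (P : probability T R) (Y : T -> R).
Hypothesis mY : measurable_fun setT Y.
Hypothesis gaussY : std_gaussian P Y.
Local Notation mu := (@lebesgue_measure R).

(** Two uses of [ge0_integral_weighted]: weight 1 carries the law of [Y] to [normal_prob], and
    weight [normal_pdf] along the identity carries [normal_prob] to Lebesgue measure. *)
Lemma ge0_expectation_gaussian (f : R -> R) : measurable_fun setT f ->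
  (forall x, 0 <= f x) ->
  (\int[P]_t (f (Y t))%:E = \int[mu]_x (normal_pdf 0 1 x * f x)%:E)%E.
Proof.
move=> mf f0.
have mpdf := @measurable_normal_pdf R 0 1.
rewrite (@ge0_integral_weighted _ _ _ _ R mu (normal_prob 0 1) id (normal_pdf 0 1) 1)//.
- have := @ge0_integral_weighted _ _ _ _ R P (normal_prob 0 1) Y (cst 1) 1.
  move=> <-//.
  + by apply: eq_integral => t _; rewrite mul1r.
  + move=> B mB; have mYB : measurable (Y @^-1` B).
      by rewrite -[_ @^-1` _]setTI; exact: mY.
    rewrite mul1e; transitivity (P (Y @^-1` B)); last exact: gaussY.
    rewrite -(setIT (Y @^-1` _)) -integral_indic//.
    by apply: eq_integral => t _; rewrite mul1r.
- by move=> x; exact: normal_pdf_ge0.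
- move=> B mB; rewrite mul1e /normal_prob [RHS]integral_mkcond.
  apply: eq_integral => x _; rewrite patchE indicE.
  by case: ifP => _; rewrite ?mulr1 ?mulr0.
Qed.

Lemma expectation_gaussianN (f : R -> R) : measurable_fun setT f ->
  (forall x, 0 <= f x) ->
  (\int[P]_t (f (Y t))%:E = \int[P]_t (f (- Y t))%:E)%E.
Proof.
move=> mf f0; rewrite ge0_expectation_gaussian//.
rewrite (@ge0_expectation_gaussian (f \o -%R)); last 2 first.
- by apply: measurableT_comp.
- by move=> x; exact: f0.
rewrite [LHS]ge0_integral_lebesgueN.
- apply: eq_integral => x _; rewrite !normal_pdfE ?oner_neq0// /normal_fun.
  by rewrite !subr0 sqrrN.
- by apply: measurable_funM => //; exact: measurable_normal_pdf.
- by move=> x; rewrite mulr_ge0 ?normal_pdf_ge0.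
Qed.

(* Tilting the standard Gaussian density by [expR (c x^2)] gives [s] times the
   centered Gaussian density of standard deviation [s]. *)
Lemma expectation_expR_sqr_gaussian (s : R) : 0 < s ->
  (\int[P]_t (expR ((1 - s ^- 2) / 2 * Y t ^+ 2))%:E = s%:E)%E.
Proof.
move=> s0; have s_neq0 : s != 0 by rewrite gt_eqF.
rewrite (@ge0_expectation_gaussian (fun x => expR ((1 - s ^- 2) / 2 * x ^+ 2))).
- transitivity (\int[mu]_x (s%:E * (normal_pdf 0 s x)%:E))%E.
    (* The exponents agree because (1 - s^-2)/2 - 1/2 = -1/(2 s^2), and the peak of the standard
       density is [s] times the peak for deviation [s]. *)
    apply: eq_integral => x _; rewrite -EFinM; congr EFin.
    rewrite !normal_pdfE ?oner_neq0// /normal_peak /normal_fun !subr0.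
    rewrite expr1n mul1r -mulrnAr sqrtrM ?sqr_ge0// sqrtr_sqr gtr0_norm//.
    rewrite [in RHS]invfM !(mulrA s) divff// mul1r -[LHS]mulrA -expRD; congr (_ * expR _).
    by rewrite -[1 *+ 2]/2 -mulr_natr; field.
  rewrite ge0_integralZl_EFin ?integral_normal_pdf ?mule1//.
  + by move=> x _; rewrite lee_fin; exact: normal_pdf_ge0.
  + by apply/measurable_EFinP; exact: measurable_normal_pdf.
  + exact: ltW.
- by apply: measurableT_comp => //; apply: measurable_funM.
- by move=> x; exact: expR_ge0.
Qed.

End gaussian.

(** * Moments up to order four *)

Section moments.
Context {R : realType} {dT : measure_display} {T : measurableType dT}.
Context (P : probability T R).

(** A Markov-type bound: integrate [b + a * g <= h]. Integrability of [g] is a by-product, because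
    an infinite integral would contradict the finite value [c]. *)
Lemma ge0_integral_le_affine (g h : T -> R) (a b c : R) : 0 < a -> 0 <= b ->
  measurable_fun setT g -> measurable_fun setT h -> (forall t, 0 <= g t) ->
  (forall t, b + a * g t <= h t) -> (\int[P]_t (h t)%:E = c%:E)%E ->
  (\int[P]_t (g t)%:E <= ((c - b) / a)%:E)%E.
Proof.
move=> a0 b0 mg mh g0 gh hc.
have a_ge0 := ltW a0.
have : (b%:E + a%:E * \int[P]_t (g t)%:E <= c%:E)%E.
  rewrite -hc -ge0_integralZl_EFin//; last 2 first.
  - by move=> t _; rewrite lee_fin.
  - exact/measurable_EFinP.
  rewrite -[X in (X + _)%E]mule1 -(@probability_setT _ _ _ P).
  rewrite -integral_cst// -ge0_integralD//; last 2 first.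
  - by move=> t _; rewrite mule_ge0// lee_fin.
  - by apply: measurable_funeM; exact/measurable_EFinP.
  apply: ge0_le_integral => //.
  - by move=> t _; rewrite -EFinM -EFinD lee_fin addr_ge0 ?mulr_ge0.
  - apply: emeasurable_funD => //.
    by apply: measurable_funeM; exact/measurable_EFinP.
  - exact/measurable_EFinP.
  - by move=> t _; rewrite -EFinM -EFinD lee_fin.
have : (0 <= \int[P]_t (g t)%:E)%E by apply: integral_ge0 => t _; rewrite lee_fin.
case: (\int[P]_t _)%E => [r| |]//= _.
  rewrite -EFinM -EFinD !lee_fin => ?; rewrite ler_pdivlMr//; lra.
by rewrite gt0_muley ?lte_fin// addey.
Qed.

Lemma integrable_exprn_le4 (Y : T -> R) (n : nat) : measurable_fun setT Y ->
  (\int[P]_t (Y t ^+ 4)%:E < +oo)%E -> (n <= 4)%N ->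
  P.-integrable setT (fun t => (Y t ^+ n)%:E).
Proof.
move=> mY Y4 n4.
have Y4_ge0 t : 0 <= Y t ^+ 4 by rewrite exprn_even_ge0.
(* For n <= 4 the power |y|^n is at most 1 when |y| <= 1 and at most y^4 otherwise. *)
apply: (@le_integrable _ _ _ P setT measurableT _ (fun t => (1 + Y t ^+ 4)%:E)).
- by apply/measurable_EFinP; exact: measurable_funX.
- move=> t _; rewrite lee_fin normrX [leRHS]ger0_norm ?addr_ge0//.
  have [Y1|/ltW Y1] := leP `|Y t| 1.
    by rewrite (@le_trans _ _ 1) ?exprn_ile1// lerDl.
  rewrite (@le_trans _ _ (`|Y t| ^+ 4))// ?ler_weXn2l//.
  by rewrite -normrX ger0_norm// lerDr.
apply/integrableP; split.
  by apply/measurable_EFinP; apply: measurable_funD => //; exact: measurable_funX.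
under eq_integral do rewrite gee0_abs ?lee_fin ?addr_ge0// EFinD.
rewrite ge0_integralD//; last 2 first.
- by move=> t _; rewrite lee_fin.
- by apply/measurable_EFinP; exact: measurable_funX.
by rewrite integral_cst//= probability_setT mule1 lte_add_pinfty// ltry.
Qed.

(** [fine] sends an infinite integral to 0, so the link with the integral ([momentE]) requires
    integrability. *)
Definition moment (Y : T -> R) (n : nat) : R := fine (\int[P]_t (Y t ^+ n)%:E)%E.

Lemma moment0 (Y : T -> R) : moment Y 0 = 1.
Proof.
rewrite /moment; under eq_integral do rewrite expr0.
by rewrite integral_cst//= probability_setT mule1.
Qed.

Lemma moment_even_ge0 (Y : T -> R) n : ~~ odd n -> 0 <= moment Y n.
Proof.
by move=> n2; apply/fine_ge0/integral_ge0 => t _; rewrite lee_fin exprn_even_ge0.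
Qed.

Lemma momentE (Y : T -> R) n : P.-integrable setT (fun t => (Y t ^+ n)%:E) ->
  (\int[P]_t (Y t ^+ n)%:E = (moment Y n)%:E)%E.
Proof. by move=> Yn; rewrite fineK// integrable_fin_num. Qed.

(* A Gaussian has second and fourth moments 1 and 3; the weaker bounds are enough
   because the target constant is 9^k, whereas the sharp one would be 3^k. *)
Record tame_moments (Y : T -> R) : Prop := TameMoments {
  tame_integrable : forall n, (n <= 4)%N ->
    P.-integrable setT (fun t => (Y t ^+ n)%:E);
  tame_moment1 : moment Y 1 = 0;
  tame_moment3 : moment Y 3 = 0;
  tame_moment2 : moment Y 2 ^+ 2 <= 3;
  tame_moment4 : moment Y 4 <= 9 }.

Section gaussian_moments.
Variable Y : T -> R.
Hypotheses (mY : measurable_fun setT Y) (gaussY : std_gaussian P Y).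

(** From exp(c y^2) >= 1 + c y^2 the second moment is at most (s - 1)/c with c = (1 - s^-2)/2. The
    choice s = 5/4 keeps everything rational and gives 25/18, whose square is below 3. *)
Lemma gaussian_moment2_le : (\int[P]_t (Y t ^+ 2)%:E <= (25 / 18)%:E)%E.
Proof.
have s0 : 0 < 5 / 4 :> R by lra.
have := expectation_expR_sqr_gaussian _ _ mY gaussY _ s0.
have -> : (1 - (5 / 4) ^- 2) / 2 = 9 / 50 :> R by field.
move=> h.
have -> : 25 / 18 = (5 / 4 - 1) / (9 / 50) :> R by field.
apply: (@ge0_integral_le_affine (fun t => Y t ^+ 2)
  (fun t => expR (9 / 50 * Y t ^+ 2))) => //.
- exact: measurable_funX.
- apply: measurableT_comp => //; apply: measurable_funM => //.
  exact: measurable_funX.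
- by move=> t; exact: sqr_ge0.
- by move=> t; exact: expR_ge1Dx.
Qed.

(** Opposite tilts [c] and [- c] are combined so that the quadratic terms in [Y] cancel and the
    fourth power is what remains, by [expRD_oppr_ge]. *)
Lemma gaussian_moment4_le_param (s s' c : R) : 0 < s -> 0 < s' -> 0 < c ->
  (1 - s ^- 2) / 2 = c -> (1 - s' ^- 2) / 2 = - c ->
  (\int[P]_t (Y t ^+ 4)%:E <= ((s + s' - 2) / (7 / 16 * c ^+ 2))%:E)%E.
Proof.
move=> s0 s'0 c0 sc s'c.
have := expectation_expR_sqr_gaussian _ _ mY gaussY _ s0; rewrite sc => h.
have := expectation_expR_sqr_gaussian _ _ mY gaussY _ s'0; rewrite s'c => h'.
have mexp (a : R) : measurable_fun setT (fun t => expR (a * Y t ^+ 2)).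
  apply: measurableT_comp => //; apply: measurable_funM => //.
  exact: measurable_funX.
have hh : (\int[P]_t (expR (c * Y t ^+ 2) + expR (- c * Y t ^+ 2))%:E = (s + s')%:E)%E.
  under eq_integral do rewrite EFinD.
  rewrite ge0_integralD ?h ?h'//.
  - by apply/measurable_EFinP; exact: mexp.
  - by apply/measurable_EFinP; exact: mexp.
apply: (@ge0_integral_le_affine (fun t => Y t ^+ 4)
  (fun t => expR (c * Y t ^+ 2) + expR (- c * Y t ^+ 2))) => //.
- by rewrite mulr_gt0 ?exprn_gt0//; lra.
- exact: measurable_funX.
- by apply: measurable_funD; exact: mexp.
- by move=> t; rewrite exprn_even_ge0.
- move=> t; have u0 : 0 <= c * Y t ^+ 2 by rewrite mulr_ge0 ?sqr_ge0// ltW.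
  by have := expRD_oppr_ge _ _ u0; rewrite mulNr exprMn -exprM mulrA.
Qed.

(* [1 - 2 c = (17/25)^2] and [1 + 2 c = (31/25)^2] for [c = 168/625]: both standard
   deviations are rational and [c] is small enough. *)
Lemma gaussian_moment4_le : (\int[P]_t (Y t ^+ 4)%:E <= 9%:E)%E.
Proof.
apply: (le_trans (@gaussian_moment4_le_param (25 / 17) (25 / 31) (168 / 625) _ _ _ _ _)).
- lra.
- lra.
- lra.
- by field.
- by field.
- by rewrite lee_fin ler_pdivrMr; lra.
Qed.

Lemma gaussian_integrable n : (n <= 4)%N -> P.-integrable setT (fun t => (Y t ^+ n)%:E).
Proof.
by apply: integrable_exprn_le4 => //; rewrite (le_lt_trans gaussian_moment4_le) ?ltry.
Qed.

(** For odd n the negative part of Y^n is the positive part of (-Y)^n, so by symmetry both parts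
    have the same integral; it is finite, hence the difference is 0. *)
Lemma gaussian_moment_odd n : (n <= 4)%N -> odd n -> moment Y n = 0.
Proof.
move=> n4 nodd; have Yn := gaussian_integrable _ n4.
pose f (x : R) := Num.max (x ^+ n) 0.
have mf : measurable_fun setT f by exact: measurable_maxr.
have f0 x : 0 <= f x by rewrite le_max lexx orbT.
have fN := expectation_gaussianN _ _ mY gaussY _ mf f0.
have pE : (\int[P]_t ((fun t => (Y t ^+ n)%:E)^\+ t) = \int[P]_t (f (Y t))%:E)%E.
  by apply: eq_integral => t _; rewrite funeposE EFin_max.
have nE : (\int[P]_t ((fun t => (Y t ^+ n)%:E)^\- t) = \int[P]_t (f (Y t))%:E)%E.
  rewrite fN; apply: eq_integral => t _.
  by rewrite funenegE /f exprNn -signr_odd nodd expr1 mulN1r EFin_max.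
have fin : (\int[P]_t (f (Y t))%:E)%E \is a fin_num.
  rewrite -pE; apply: integrable_fin_num => //.
  exact: integrable_funepos.
by rewrite /moment integralE pE nE subee.
Qed.

Lemma tame_moments_gaussian : tame_moments Y.
Proof.
split; [exact: gaussian_integrable|exact: gaussian_moment_odd|
  exact: gaussian_moment_odd| |].
- have m2 := moment_even_ge0 Y 2 isT.
  have m2' : moment Y 2 <= 25 / 18.
    by rewrite -lee_fin -momentE ?gaussian_moment2_le//; exact: gaussian_integrable.
  have : moment Y 2 ^+ 2 <= (25 / 18) ^+ 2 by rewrite lerXn2r// nnegrE; lra.
  by move=> /le_trans; apply; lra.
- by rewrite -lee_fin -momentE ?gaussian_moment4_le//; exact: gaussian_integrable.
Qed.

End gaussian_moments.

Section rademacher_moments.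
Variable Y : T -> R.
Hypotheses (mY : measurable_fun setT Y) (radY : rademacher P Y).

(** The law is prescribed only through its two atoms. Their masses add up to 1, so other values form
    a null event and f(Y) agrees almost everywhere with the two-step function [g]. *)
Lemma expectation_rademacher (f : R -> R) : measurable_fun setT f ->
  (\int[P]_t (f (Y t))%:E = ((f 1 + f (-1)) / 2)%:E)%E.
Proof.
move=> mf; case: radY => P1 PN1.
have mY1 (x : R) : measurable (Y @^-1` [set x]).
  by rewrite -[_ @^-1` _]setTI; exact: mY.
have n1 : (1 : R) <> -1 by move=> /eqP; rewrite -subr_eq0 opprK (pnatr_eq0 R 2).
have disj : Y @^-1` [set 1] `&` Y @^-1` [set -1] = set0.
  by apply/seteqP; split=> // t [/= ->].
pose g t : R := f 1 * \1_(Y @^-1` [set 1]) t + f (-1) * \1_(Y @^-1` [set -1]) t.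
have indint (x : R) : P.-integrable setT (fun t => (\1_(Y @^-1` [set x]) t)%:E).
  exact: integrable_indic.
have gE : (\int[P]_t (g t)%:E = ((f 1 + f (-1)) / 2)%:E)%E.
  under eq_integral do rewrite EFinD !EFinM.
  rewrite integralD//; [|exact: integrableZl|exact: integrableZl].
  rewrite !integralZl// !integral_indic// !setIT.
  rewrite [X in (_ * X + _)%E]P1 [X in (_ + _ * X)%E]PN1.
  by rewrite -!EFinM -EFinD; congr EFin; field.
have P0 : P (~` (Y @^-1` [set 1] `|` Y @^-1` [set -1])) = 0%E.
  rewrite probability_setC ?measureU//; last exact: measurableU.
  rewrite [X in (_ - (X + _))%E]P1 [X in (_ - (_ + X))%E]PN1.
  by rewrite -EFinD -splitr subrr.
rewrite -gE; apply: ae_eq_integral => //.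
- by apply/measurable_EFinP; exact: measurableT_comp.
- by apply/measurable_EFinP; apply: measurable_funD; apply: measurable_funM => //;
     exact: measurable_indic.
exists (~` (Y @^-1` [set 1] `|` Y @^-1` [set -1])); split.
- by apply: measurableC; exact: measurableU.
- exact: P0.
- move=> t /= H [] Yt; apply: H => _; rewrite /g !indicE Yt; congr EFin.
  + by rewrite mem_set// memNset ?mulr1 ?mulr0 ?addr0//= Yt; exact: n1.
  + rewrite memNset; last by rewrite /= Yt => /esym/n1.
    by rewrite mem_set// mulr1 mulr0 add0r.
Qed.

Lemma rademacher_moment n : moment Y n = (1 + (-1) ^+ n) / 2.
Proof.
by rewrite /moment (expectation_rademacher (fun x => x ^+ n))//= expr1n.
Qed.

Lemma tame_moments_rademacher : tame_moments Y.
Proof.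
split; rewrite ?rademacher_moment.
- move=> n; apply: integrable_exprn_le4 => //.
  by rewrite (expectation_rademacher (fun x => x ^+ 4))// ltry.
- by rewrite expr1 subrr mul0r.
- by rewrite -signr_odd expr1 subrr mul0r.
- by rewrite sqrrN expr1n -mulr2n -[1 *+ 2]/2 divff// expr1n ler1n.
- by rewrite -signr_odd expr0 -mulr2n -[1 *+ 2]/2 divff// ler1n.
Qed.

End rademacher_moments.

End moments.

(** * Cauchy-Schwarz and sums over paired indices *)

Section finite_sums.
Context {R : rcfType}.

Definition l2norm {n} (a : 'I_n -> R) : R := Num.sqrt (\sum_i a i ^+ 2).

Lemma l2norm_ge0 n (a : 'I_n -> R) : 0 <= l2norm a.
Proof. exact: sqrtr_ge0. Qed.

Lemma sqr_l2norm n (a : 'I_n -> R) : l2norm a ^+ 2 = \sum_i a i ^+ 2.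
Proof. by rewrite sqr_sqrtr// sumr_ge0// => i _; rewrite sqr_ge0. Qed.

(** Lagrange's identity: the sum of the squares (a_i b_j - a_j b_i)^2 over all i, j is twice the gap
    between the squared sides. *)
Lemma cauchy_schwarz n (a b : 'I_n -> R) :
  \sum_i a i * b i <= l2norm a * l2norm b.
Proof.
have ab2 : (\sum_i a i * b i) ^+ 2 <= (l2norm a * l2norm b) ^+ 2.
  rewrite exprMn !sqr_l2norm -subr_ge0.
  have : 0 <= \sum_i \sum_j (a i * b j - a j * b i) ^+ 2.
    by apply: sumr_ge0 => i _; apply: sumr_ge0 => j _; exact: sqr_ge0.
  have -> : \sum_i \sum_j (a i * b j - a j * b i) ^+ 2 =
      \sum_i \sum_j (a i ^+ 2 * b j ^+ 2) + \sum_i \sum_j (b i ^+ 2 * a j ^+ 2)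
      - 2 * \sum_i \sum_j ((a i * b i) * (a j * b j)).
    rewrite mulr_sumr -sumrN -!big_split/=; apply: eq_bigr => i _.
    rewrite mulr_sumr -sumrN -!big_split/=; apply: eq_bigr => j _; ring.
  by rewrite -!big_distrlr/= -expr2; set x := \sum_i _; set y := \sum_i _; lra.
apply: le_trans (ler_norm _) _.
rewrite -[leRHS]ger0_norm ?mulr_ge0 ?l2norm_ge0//.
by rewrite -ler_sqr ?nnegrE ?normr_ge0// !real_normK ?num_real.
Qed.

Definition sum4 {n} (H : 'I_n -> 'I_n -> 'I_n -> 'I_n -> R) : R :=
  \sum_p \sum_q \sum_r \sum_s H p q r s.

Lemma eq_sum4 n (H H' : 'I_n -> 'I_n -> 'I_n -> 'I_n -> R) :
  (forall p q r s, H p q r s = H' p q r s) -> sum4 H = sum4 H'.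
Proof.
by move=> HH'; do 4 (apply: eq_bigr => ? _); exact: HH'.
Qed.

Lemma ler_sum4 n (H H' : 'I_n -> 'I_n -> 'I_n -> 'I_n -> R) :
  (forall p q r s, H p q r s <= H' p q r s) -> sum4 H <= sum4 H'.
Proof.
by move=> HH'; do 4 (apply: ler_sum => ? _); exact: HH'.
Qed.

Lemma mulr_sum4 n (c : R) (H : 'I_n -> 'I_n -> 'I_n -> 'I_n -> R) :
  c * sum4 H = sum4 (fun p q r s => c * H p q r s).
Proof. by rewrite /sum4; do 4 (rewrite mulr_sumr; apply: eq_bigr => ? _). Qed.

(** The Wick (Isserlis) value of E[g_p g_q g_r g_s] for independent standard Gaussians: one term per
    perfect matching of the four positions, hence 3 when all indices agree. *)
Definition pairings {n} (p q r s : 'I_n) : R :=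
  ((p == q) && (r == s))%:R + ((p == r) && (q == s))%:R + ((p == s) && (q == r))%:R.

Lemma pairings_ge0 n (p q r s : 'I_n) : 0 <= pairings p q r s.
Proof. by rewrite /pairings !addr_ge0. Qed.

Lemma sum4_pairings n (a b c e : 'I_n -> R) :
  sum4 (fun p q r s => pairings p q r s * (a p * b q * c r * e s)) =
  (\sum_p a p * b p) * (\sum_r c r * e r) + (\sum_p a p * c p) * (\sum_q b q * e q)
  + (\sum_p a p * e p) * (\sum_q b q * c q).
Proof.
have sum_delta (p : 'I_n) (F : 'I_n -> R) : \sum_q (p == q)%:R * F q = F p.
  rewrite (bigD1 p)//= eqxx mul1r big1 ?addr0// => q /negbTE qp.
  by rewrite eq_sym qp mul0r.
rewrite /sum4 /pairings !big_distrlr/= -!big_split/=; apply: eq_bigr => p _.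
transitivity (\sum_q \sum_r \sum_s ((p == q)%:R * ((r == s)%:R * (a p * b q * c r * e s)))
  + \sum_q \sum_r \sum_s ((p == r)%:R * ((q == s)%:R * (a p * b q * c r * e s)))
  + \sum_q \sum_r \sum_s ((p == s)%:R * ((q == r)%:R * (a p * b q * c r * e s)))).
  rewrite -!big_split/=; apply: eq_bigr => q _; rewrite -!big_split/=.
  apply: eq_bigr => r _; rewrite -!big_split/=; apply: eq_bigr => s _.
  by rewrite -!mulnb !natrM; ring.
congr (_ + _ + _).
- transitivity (\sum_q (p == q)%:R * \sum_r (a p * b q * c r * e r)).
    apply: eq_bigr => q _; rewrite mulr_sumr; apply: eq_bigr => r _.
    by rewrite -mulr_sumr sum_delta.
  by rewrite sum_delta; apply: eq_bigr => r _; ring.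
- apply: eq_bigr => q _.
  transitivity (\sum_r (p == r)%:R * (a p * b q * c r * e q)).
    by apply: eq_bigr => r _; rewrite -mulr_sumr sum_delta.
  by rewrite sum_delta; ring.
- apply: eq_bigr => q _.
  transitivity (\sum_r (q == r)%:R * (a p * b q * c r * e p)).
    by apply: eq_bigr => r _; rewrite sum_delta.
  by rewrite sum_delta; ring.
Qed.

(** Each of the three matchings leaves a product of two inner products, and Cauchy-Schwarz bounds
    every one of them by the same product of four norms. *)
Lemma sum4_pairings_le n (a b c e : 'I_n -> R) :
  (forall i, 0 <= a i) -> (forall i, 0 <= b i) ->
  (forall i, 0 <= c i) -> (forall i, 0 <= e i) ->
  sum4 (fun p q r s => pairings p q r s * (a p * b q * c r * e s)) <=
  3 * (l2norm a * l2norm b * l2norm c * l2norm e).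
Proof.
move=> a0 b0 c0 e0; rewrite sum4_pairings.
have prod_le (x y z w : 'I_n -> R) : (forall i, 0 <= x i) -> (forall i, 0 <= y i) ->
    (forall i, 0 <= z i) -> (forall i, 0 <= w i) ->
    (\sum_i x i * y i) * (\sum_i z i * w i) <=
    l2norm x * l2norm y * (l2norm z * l2norm w).
  move=> x0 y0 z0 w0; rewrite ler_pM ?cauchy_schwarz//.
    by rewrite sumr_ge0// => i _; rewrite mulr_ge0.
  by rewrite sumr_ge0// => i _; rewrite mulr_ge0.
have := prod_le a b c e a0 b0 c0 e0.
have := prod_le a c b e a0 c0 b0 e0.
have := prod_le a e b c a0 e0 b0 c0.
set x := _ * \sum_i _; set y := _ * \sum_i _; set z := _ * \sum_i _; lra.
Qed.

End finite_sums.

(** * Indices of a tensor power as strings of digits *)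

Section kronecker_index.
Context {d : nat}.

Definition tcons {k} (j : 'I_d) (p : 'I_(d ^ k)) : 'I_(d ^ k.+1) :=
  cast_ord (esym (expnS d k)) (mxtens_index (j, p)).

Fixpoint digit {k} : 'I_(d ^ k) -> 'I_k -> 'I_d :=
  match k with
  | 0 => fun _ i => match i with Ordinal m m_lt0 => False_rect _ (notF m_lt0) end
  | k'.+1 => fun p i =>
      let jp := mxtens_unindex (cast_ord (expnS d k') p) in
      if unlift ord0 i is Some i' then digit jp.2 i' else jp.1
  end.

Lemma digitS k (p : 'I_(d ^ k.+1)) i :
  let jp := mxtens_unindex (cast_ord (expnS d k) p) in
  digit p i = if unlift ord0 i is Some i' then digit jp.2 i' else jp.1.
Proof. by []. Qed.

Lemma digit_tcons0 k (j : 'I_d) (p : 'I_(d ^ k)) : digit (tcons j p) ord0 = j.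
Proof. by rewrite digitS unlift_none /tcons cast_ordKV mxtens_indexK. Qed.

Lemma digit_tconsS k (j : 'I_d) (p : 'I_(d ^ k)) i :
  digit (tcons j p) (lift ord0 i) = digit p i.
Proof. by rewrite digitS liftK /tcons cast_ordKV mxtens_indexK. Qed.

Lemma tcons_surj k (p : 'I_(d ^ k.+1)) : exists j p', p = tcons j p'.
Proof.
pose jp := mxtens_unindex (cast_ord (expnS d k) p).
exists jp.1, jp.2; rewrite /tcons -surjective_pairing mxtens_unindexK.
by rewrite cast_ordK.
Qed.

Lemma sum_tcons (R : nmodType) k (F : 'I_(d ^ k.+1) -> R) :
  \sum_p F p = \sum_j \sum_(p < d ^ k) F (tcons j p).
Proof.
rewrite pair_big/= (reindex (fun jp : 'I_d * 'I_(d ^ k) => tcons jp.1 jp.2))//=.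
exists (fun p => mxtens_unindex (cast_ord (expnS d k) p)) => [[j p]|p] _.
  by rewrite /tcons cast_ordKV mxtens_indexK.
by rewrite /tcons -surjective_pairing mxtens_unindexK cast_ordK.
Qed.

Lemma kronvE (R : comPzRingType) k (x : 'I_k -> 'cV[R]_d) (p : 'I_(d ^ k)) :
  kronv x p 0 = \prod_i x i (digit p i) 0.
Proof.
elim: k x p => [|k IHk] x p.
  by rewrite big_ord0 /= castmxE !ord1 mxE eqxx.
rewrite big_ord_recl; have [j [p' ->]] := tcons_surj _ p.
rewrite digit_tcons0; under eq_bigr do rewrite digit_tconsS.
rewrite -(IHk (fun i => x (lift ord0 i))).
change (kronv x) with (castmx (esym (expnS d k), muln1 1)
  (tensmx (x ord0) (kronv (fun i => x (lift ord0 i))))).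
rewrite castmxE mxE; set z := mxtens_unindex (cast_ord _ 0).
by rewrite (ord1 z.1) (ord1 z.2) esymK /tcons cast_ordKV mxtens_indexK.
Qed.

(** Exchanging sums moves the four first digits outside, so the inner sum has the same shape one
    level down. *)
Lemma sum4_tcons (R : rcfType) k
    (H : 'I_(d ^ k.+1) -> 'I_(d ^ k.+1) -> 'I_(d ^ k.+1) -> 'I_(d ^ k.+1) -> R) :
  sum4 H = sum4 (fun j1 j2 j3 j4 => sum4 (fun p q r s =>
    H (tcons j1 p) (tcons j2 q) (tcons j3 r) (tcons j4 s))).
Proof.
rewrite /sum4 sum_tcons; apply: eq_bigr => j1 _.
under eq_bigr do rewrite sum_tcons.
rewrite exchange_big; apply: eq_bigr => j2 _.
under eq_bigr do under eq_bigr do rewrite sum_tcons.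
under eq_bigr do rewrite exchange_big.
rewrite exchange_big; apply: eq_bigr => j3 _.
under eq_bigr do under eq_bigr do under eq_bigr do rewrite sum_tcons.
under eq_bigr do under eq_bigr do rewrite exchange_big.
under eq_bigr do rewrite exchange_big.
by rewrite exchange_big.
Qed.

(** This closes the induction on [k]: the outer step sees only the slice norms, and their norm is
    again the norm of the full vector. *)
Lemma l2norm_tcons (R : rcfType) k (a : 'I_(d ^ k.+1) -> R) :
  l2norm (fun j => l2norm (fun p : 'I_(d ^ k) => a (tcons j p))) = l2norm a.
Proof.
rewrite {1}/l2norm; under eq_bigr do rewrite sqr_l2norm.
by rewrite /l2norm sum_tcons.
Qed.

(* Decoupled hypercontractivity: peeling off one tensor factor costs a factor 3. *)
Lemma sum4_digit_pairings_le (R : rcfType) k (a b c e : 'I_(d ^ k) -> R) :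
  (forall i, 0 <= a i) -> (forall i, 0 <= b i) ->
  (forall i, 0 <= c i) -> (forall i, 0 <= e i) ->
  sum4 (fun p q r s => a p * b q * c r * e s *
    \prod_i pairings (digit p i) (digit q i) (digit r i) (digit s i)) <=
  3 ^+ k * (l2norm a * l2norm b * l2norm c * l2norm e).
Proof.
elim: k a b c e => [|k IHk] a b c e a0 b0 c0 e0.
  have norm1 (x : 'I_1 -> R) : (forall i, 0 <= x i) -> l2norm x = x ord0.
    by move=> x0; rewrite /l2norm big_ord1 sqrtr_sqr ger0_norm.
  rewrite expr0 mul1r (norm1 a)// (norm1 b)// (norm1 c)// (norm1 e)//.
  by rewrite /sum4 !(@big_ord1 _ _ _) big_ord0 mulr1.
rewrite sum4_tcons.
(* Once the first digits are fixed, the induction hypothesis bounds the inner sum by slice norms;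
   these norms are the vectors fed to [sum4_pairings_le]. *)
pose n2 (x : 'I_(d ^ k.+1) -> R) j := l2norm (fun p : 'I_(d ^ k) => x (tcons j p)).
apply: (@le_trans _ _ (3 ^+ k * sum4 (fun j1 j2 j3 j4 =>
    pairings j1 j2 j3 j4 * (n2 a j1 * n2 b j2 * n2 c j3 * n2 e j4)))).
  rewrite mulr_sum4; apply: ler_sum4 => j1 j2 j3 j4.
  rewrite mulrCA.
  apply: (@le_trans _ _ (pairings j1 j2 j3 j4 * sum4 (fun p q r s =>
      a (tcons j1 p) * b (tcons j2 q) * c (tcons j3 r) * e (tcons j4 s) *
      \prod_i pairings (digit p i) (digit q i) (digit r i) (digit s i)))).
    rewrite mulr_sum4 le_eqVlt; apply/orP; left; apply/eqP.
    apply: eq_sum4 => p q r s; rewrite big_ord_recl !digit_tcons0 mulrCA.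
    by congr (_ * (_ * _)); apply: eq_bigr => i _; rewrite !digit_tconsS.
  by rewrite ler_wpM2l ?pairings_ge0//; apply: IHk.
rewrite exprSr -[in leRHS]mulrA ler_wpM2l ?exprn_ge0//.
rewrite -(l2norm_tcons _ _ a) -(l2norm_tcons _ _ b) -(l2norm_tcons _ _ c) -(l2norm_tcons _ _ e).
by apply: sum4_pairings_le => j; exact: l2norm_ge0.
Qed.

End kronecker_index.

(** Nonnegativity of the principal 2 x 2 minor, read off from the form at x e_p + y e_q without
    dividing. *)
Lemma psd_entry_sqr_le (R : realDomainType) n (A : 'M[R]_n) p q : psd A ->
  A p q ^+ 2 <= A p p * A q q.
Proof.
move=> [AT A0].
have Aqp : A q p = A p q by rewrite -{1}AT mxE.
have form x y : 0 <= x ^+ 2 * A p p + 2 * (x * y * A p q) + y ^+ 2 * A q q.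
  have := A0 (x *: delta_mx p 0 + y *: delta_mx q 0).
  rewrite [_^T]linearD/= [X in (X + _) *m _]linearZ/= [X in (_ + X) *m _]linearZ/=.
  rewrite !trmx_delta mulmxDl mulmxDr -!scalemxAl !mulmxDl -!scalemxAl -!scalemxAr.
  have dE i j : (delta_mx 0 i *m A *m delta_mx j 0 : 'M[R]_1) 0 0 = A i j.
    by rewrite -rowE -colE !mxE.
  have addE (B C : 'M[R]_1) : (B + C) 0 0 = B 0 0 + C 0 0 by rewrite mxE.
  have scaleE c (B : 'M[R]_1) : (c *: B) 0 0 = c * B 0 0 by rewrite mxE.
  rewrite !(addE, scaleE, dE) Aqp.
  set l := _ + _.
  rewrite (_ : l = x ^+ 2 * A p p + 2 * (x * y * A p q) + y ^+ 2 * A q q)//.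
  by rewrite /l; ring.
have Ap := form 1 0; have Aq := form 0 1.
have [Aq0|Aq0] := eqVneq (A q q) 0.
  (* With A_qq = 0 this vector gives -A_pq^2 (A_pp + 2) >= 0, and A_pp >= 0 forces A_pq = 0. *)
  have := form (A p q) (- (A p p + 1)); rewrite Aq0 => h; nra.
have {}Aq0 : 0 < A q q by rewrite lt_def Aq0; lra.
(* Here the form equals A_qq times the minor, and A_qq > 0. *)
have := form (A q q) (- A p q).
rewrite (_ : _ + _ = A q q * (A p p * A q q - A p q ^+ 2)); last by ring.
by rewrite pmulr_rge0// subr_ge0.
Qed.

(** * Mixed fourth moments within one component *)

Section multiplicities.
Context {R : rcfType} {d : nat}.

Definition multiplicity (p q r s j : 'I_d) : nat :=
  ((p == j) + (q == j) + (r == j) + (s == j))%N.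

Lemma multiplicity_le4 p q r s j : (multiplicity p q r s j <= 4)%N.
Proof. by rewrite /multiplicity; do 4 case: (_ == j). Qed.

(** Regrouping by coordinate leaves one power per coordinate, the form to which independence
    applies. *)
Lemma prod_multiplicity (x : 'I_d -> R) (p q r s : 'I_d) :
  x p * x q * x r * x s = \prod_j x j ^+ multiplicity p q r s j.
Proof.
have xE i : x i = \prod_j x j ^+ (i == j).
  rewrite (bigD1 i)//= eqxx expr1 big1 ?mulr1// => j /negbTE ji.
  by rewrite eq_sym ji expr0.
rewrite {1}(xE p) {1}(xE q) {1}(xE r) {1}(xE s) -!big_split/=.
by apply: eq_bigr => j _; rewrite -!exprD.
Qed.

Variable e : 'I_d -> nat -> R.
Hypotheses (e0 : forall j, e j 0 = 1) (e1 : forall j, e j 1 = 0).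
Hypothesis (e3 : forall j, e j 3 = 0).
Hypotheses (e2_ge0 : forall j, 0 <= e j 2) (e2_le : forall j, e j 2 ^+ 2 <= 3).
Hypotheses (e4_ge0 : forall j, 0 <= e j 4) (e4_le : forall j, e j 4 <= 9).

(** With [e j n] standing for the n-th moment of coordinate [j], exponents never exceed 4 and orders
    1 and 3 vanish, so each factor is 0 or an even moment. *)
Lemma prod_moments_ge0 p q r s : 0 <= \prod_j e j (multiplicity p q r s j).
Proof.
apply: prodr_ge0 => j _; have := multiplicity_le4 p q r s j.
by case: (multiplicity _ _ _ _ _) => [|[|[|[|[|]]]]]// _; rewrite ?e0 ?e1 ?e3.
Qed.

Lemma prod_moments_odd p q r s j : odd (multiplicity p q r s j) ->
  \prod_j e j (multiplicity p q r s j) = 0.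
Proof.
move=> jodd; rewrite (bigD1 j)//= (_ : e j _ = 0) ?mul0r//.
have := multiplicity_le4 p q r s j; move: jodd.
by case: (multiplicity _ _ _ _ _) => [|[|[|[|[|]]]]]// _ _; rewrite ?e1 ?e3.
Qed.

Lemma prod_moments_pairs p r (n : 'I_d -> nat) : p != r ->
  (forall j, n j = (2 * (p == j) + 2 * (r == j))%N) -> \prod_j e j (n j) <= 3.
Proof.
move=> pr nE; rewrite (bigD1 p)//= (bigD1 r)/=; last by rewrite eq_sym.
rewrite big1; last first.
  by move=> j /andP[/negbTE jp /negbTE jr]; rewrite nE eq_sym jp eq_sym jr e0.
rewrite !nE !eqxx (negbTE pr) eq_sym (negbTE pr) mulr1 !muln1 muln0 addn0 add0n.
have := e2_le p; have := e2_le r; have := e2_ge0 p; have := e2_ge0 r.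
(* x y <= (x^2 + y^2)/2 <= 3, which is why the hypothesis bounds the square of the second moment. *)
set x := e p 2; set y := e r 2; move=> y0 x0 y3 x3; nra.
Qed.

(** Three cases: an index of odd multiplicity kills the moment; four equal indices give at most 9,
    with three pairings; two distinct pairs give at most 3, with at least one pairing. *)
Lemma prod_moments_le p q r s :
  \prod_j e j (multiplicity p q r s j) <= 3 * pairings p q r s.
Proof.
have odd_case j : odd (multiplicity p q r s j) ->
    \prod_j e j (multiplicity p q r s j) <= 3 * pairings p q r s.
  by move=> /prod_moments_odd ->; rewrite mulr_ge0 ?pairings_ge0.
have pair_case p' r' : p' != r' -> 1 <= pairings p q r s :> R ->
   (forall j, multiplicity p q r s j = (2 * (p' == j) + 2 * (r' == j))%N) ->
    \prod_j e j (multiplicity p q r s j) <= 3 * pairings p q r s.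
  move=> pr pair1 nE; apply: (le_trans (@prod_moments_pairs p' r' _ pr nE)).
  by rewrite ler_peMr.
have [pq|pq] := eqVneq p q; have [rs|rs] := eqVneq r s.
- have [pr|pr] := eqVneq p r.
    rewrite -rs -pq -pr /pairings eqxx/= (bigD1 p)//= big1; last first.
      by move=> j /negbTE jp; rewrite /multiplicity eq_sym jp e0.
    by rewrite mulr1 /multiplicity eqxx; have := e4_le p; rewrite /=; lra.
  apply: (pair_case p r) => // [|j].
    by rewrite /pairings pq rs !eqxx/= -addrA lerDl addr_ge0.
  by rewrite /multiplicity -pq -rs !mul2n -!addnn addnA.
- apply: (odd_case r); rewrite /multiplicity pq eqxx [s == r]eq_sym (negbTE rs) addn0.
  by rewrite addnn addn1/= odd_double.
- apply: (odd_case p); rewrite /multiplicity rs eqxx [q == p]eq_sym (negbTE pq) addn0.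
  by rewrite -addnA addnn oddD odd_double.
- have [pr|pr] := eqVneq p r.
    have [qs|qs] := eqVneq q s.
      apply: (pair_case p q) => // [|j].
        by rewrite /pairings pr qs !eqxx/= addrAC lerDr addr_ge0.
      by rewrite /multiplicity -pr -qs; case: (p == j); case: (q == j).
    apply: (odd_case q); rewrite /multiplicity -pr eqxx (negbTE pq).
    by rewrite [s == q]eq_sym (negbTE qs).
  have [ps|ps] := eqVneq p s.
    have [qr|qr] := eqVneq q r.
      apply: (pair_case p q) => // [|j].
        by rewrite /pairings ps qr !eqxx/= lerDr addr_ge0.
      by rewrite /multiplicity -ps -qr; case: (p == j); case: (q == j).
    apply: (odd_case q); rewrite /multiplicity -ps eqxx (negbTE pq).
    by rewrite [r == q]eq_sym (negbTE qr).
  apply: (odd_case p); rewrite /multiplicity eqxx [q == p]eq_sym (negbTE pq).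
  by rewrite [r == p]eq_sym (negbTE pr) [s == p]eq_sym (negbTE ps).
Qed.

End multiplicities.

(** * Means, variance and the quadratic form *)

Section mean.
Context {R : realType} {dT : measure_display} {T : measurableType dT}.
Context (P : probability T R).

Definition has_mean (F : T -> R) (e : R) : Prop :=
  P.-integrable setT (fun t => (F t)%:E) /\ (\int[P]_t (F t)%:E = e%:E)%E.

Lemma has_mean_sum (I : finType) (F : I -> T -> R) (e : I -> R) :
  (forall i, has_mean (F i) (e i)) ->
  has_mean (fun t => \sum_i F i t) (\sum_i e i).
Proof.
move=> Fe; split.
  under eq_fun do rewrite -sumEFin.
  by apply: integrable_sum => // i _; have [] := Fe i.
under eq_integral do rewrite -sumEFin.
rewrite integral_sum//; last by move=> i; have [] := Fe i.
by rewrite -sumEFin; apply: eq_bigr => i _; have [] := Fe i.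
Qed.

Lemma has_meanZ (F : T -> R) (e c : R) : has_mean F e ->
  has_mean (fun t => c * F t) (c * e).
Proof.
move=> [intF Fe]; split.
  by under eq_fun do rewrite EFinM; exact: integrableZl.
by under eq_integral do rewrite EFinM; rewrite integralZl// Fe.
Qed.

Lemma has_mean_sum4 n (F : 'I_n -> 'I_n -> 'I_n -> 'I_n -> T -> R)
    (e : 'I_n -> 'I_n -> 'I_n -> 'I_n -> R) :
  (forall p q r s, has_mean (F p q r s) (e p q r s)) ->
  has_mean (fun t => sum4 (fun p q r s => F p q r s t)) (sum4 e).
Proof. by move=> Fe; do 4 (apply: has_mean_sum => ?); exact: Fe. Qed.

(** The variance is E[Q^2] - (E Q)^2; integrability of [Q] itself, needed for this expansion,
    follows from |Q| <= 1 + Q^2. *)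
Lemma variance_le_sqr_mean (Q : T -> R) (e : R) : measurable_fun setT Q ->
  has_mean (fun t => Q t ^+ 2) e -> (variance P Q <= e%:E)%E.
Proof.
move=> mQ [intQ2 Q2e].
have intQ : P.-integrable setT (EFin \o Q).
  apply: (@le_integrable _ _ _ P setT measurableT _ (fun t => (1 + Q t ^+ 2)%:E)).
  - exact/measurable_EFinP.
  - move=> t _ /=; rewrite lee_fin [leRHS]ger0_norm ?addr_ge0 ?sqr_ge0//.
    rewrite -[Q t ^+ 2]real_normK ?num_real//.
    by have := sqr_ge0 (`|Q t| - 1); set x := `|Q t|; have := sqr_ge0 x; nra.
  - under eq_fun do rewrite EFinD.
    apply: integrableD => //; exact: finite_measure_integrable_cst.
have L1Q : Q \in Lfun P 1 by exact/Lfun1_integrable.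
have L1QQ : (Q * Q) \in Lfun P 1.
  by apply/Lfun1_integrable.
rewrite /variance covarianceE//.
have -> : ('E_P[Q * Q] = e%:E)%E by rewrite unlock -Q2e.
have := expectation_fin_num L1Q.
case: ('E_P[Q])%E => // m _.
by rewrite -EFinM -EFinB lee_fin lerBlDr lerDl -expr2 sqr_ge0.
Qed.

End mean.

Lemma quad_formE (R : comPzRingType) n (A : 'M[R]_n) (v : 'cV[R]_n) :
  (v^T *m A *m v) 0 0 = \sum_p \sum_q A p q * (v p 0 * v q 0).
Proof.
rewrite mxE exchange_big/=; apply: eq_bigr => q _.
rewrite mxE mulr_suml; apply: eq_bigr => p _.
by rewrite mxE; ring.
Qed.

Lemma sqr_quad_formE (R : rcfType) n (A : 'M[R]_n) (v : 'cV[R]_n) :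
  ((v^T *m A *m v) 0 0) ^+ 2 = sum4 (fun p q r s =>
    A p q * A r s * (v p 0 * v q 0 * v r 0 * v s 0)).
Proof.
rewrite quad_formE expr2 /sum4 mulr_suml; apply: eq_bigr => p _.
rewrite mulr_suml; apply: eq_bigr => q _.
rewrite mulr_sumr; apply: eq_bigr => r _.
rewrite mulr_sumr; apply: eq_bigr => s _.
by ring.
Qed.

Theorem theorem4 (R : realType) (dT : measure_display) (T : measurableType dT)
    (P : probability T R) (d k : nat) (A : 'M[R]_(d ^ k))
    (gauss : 'I_k -> bool) (X : 'I_k -> T -> 'cV[R]_d) :
  psd A ->
  (forall (i : 'I_k) (j : 'I_d), measurable_fun setT (fun t => X i t j 0)) ->
  mutually_independent P (fun ij : 'I_k * 'I_d => fun t => X ij.1 t ij.2 0) ->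
  (forall (i : 'I_k) (j : 'I_d),
     if gauss i then std_gaussian P (fun t => X i t j 0)
     else rademacher P (fun t => X i t j 0)) ->
  (variance P (fun t => ((kronv (fun i => X i t))^T *m A *m kronv (fun i => X i t)) 0 0)%R
     <= ((3 ^+ k * \tr A) ^+ 2)%:E)%E.
Proof.
move=> psdA mX indepX distX.
have tame i j : tame_moments P (fun t => X i t j 0).
  by have := distX i j; case: (gauss i); [exact: tame_moments_gaussian|
    exact: tame_moments_rademacher].
pose mom i j n := moment P (fun t => X i t j 0) n.
pose V t p := kronv (fun i => X i t) p 0.
pose mult (p q r s : 'I_(d ^ k)) i :=
  multiplicity (digit p i) (digit q i) (digit r i) (digit s i).
pose M p q r s := \prod_i \prod_j mom i j (mult p q r s i j).
(* The double product over components and coordinates is flattened to one over pairs, the index type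
   of the family in [indepX]. *)
have VE p q r s t : V t p * V t q * V t r * V t s =
    \prod_ij X ij.1 t ij.2 0 ^+ mult p q r s ij.1 ij.2.
  rewrite /V !kronvE -!big_split/= -(pair_big xpredT xpredT
    (fun i j => X i t j 0 ^+ mult p q r s i j))/=.
  by apply: eq_bigr => i _; rewrite (prod_multiplicity (fun j => X i t j 0)).
have meanV p q r s : has_mean P (fun t => V t p * V t q * V t r * V t s) (M p q r s).
  have ME : M p q r s = \prod_ij mom ij.1 ij.2 (mult p q r s ij.1 ij.2).
    by rewrite /M pair_big.
  have Xint ij : P.-integrable setT
      (fun t => (X ij.1 t ij.2 0 ^+ mult p q r s ij.1 ij.2)%:E).
    by apply: (tame_integrable _ _ (tame ij.1 ij.2)); exact: multiplicity_le4.
  rewrite ME (_ : (fun t => _) = fun t =>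
    \prod_ij X ij.1 t ij.2 0 ^+ mult p q r s ij.1 ij.2); last exact/funext/VE.
  apply: (integral_prod _ _ _ indepX
    (fun ij x => x ^+ mult p q r s ij.1 ij.2)).
  - by move=> ij; exact: mX.
  - by move=> ij; exact: exprn_measurable.
  - exact: Xint.
  - by move=> ij; exact: momentE.
pose a p := Num.sqrt (A p p).
have A_ge0 p : 0 <= A p p.
  have := psdA.2 (delta_mx p 0).
  by rewrite trmx_delta -rowE -colE !mxE.
have a_ge0 p : 0 <= a p by exact: sqrtr_ge0.
have A_le p q : `|A p q| <= a p * a q.
  by rewrite /a -sqrtrM// -sqrtr_sqr ler_wsqrtr// psd_entry_sqr_le.
have M_bounds p q r s : 0 <= M p q r s <= \prod_i (3 * pairings (digit p i)
    (digit q i) (digit r i) (digit s i)).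
  have e0 i j : mom i j 0 = 1 by exact: moment0.
  have e1 i j : mom i j 1 = 0 by exact: tame_moment1.
  have e3 i j : mom i j 3 = 0 by exact: tame_moment3.
  have e2_ge0 i j : 0 <= mom i j 2 by exact: moment_even_ge0.
  have e4_ge0 i j : 0 <= mom i j 4 by exact: moment_even_ge0.
  have e2_le i j : mom i j 2 ^+ 2 <= 3 by exact: tame_moment2.
  have e4_le i j : mom i j 4 <= 9 by exact: tame_moment4.
  rewrite /M prodr_ge0/=; last by move=> i _; exact: prod_moments_ge0.
  by apply: ler_prod => i _; rewrite prod_moments_ge0//= prod_moments_le.
set Q := (X in variance P X).
have mQ : measurable_fun setT Q.
  rewrite /Q; under eq_fun do rewrite quad_formE.
  apply: measurable_sum => p; apply: measurable_sum => q.
  have mV p' : measurable_fun setT (fun t => V t p').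
    by rewrite /V; under eq_fun do rewrite kronvE; exact: measurable_prod.
  by apply: measurable_funM => //; apply: measurable_funM; exact: mV.
have Q2 : has_mean P (fun t => Q t ^+ 2)
    (sum4 (fun p q r s => A p q * A r s * M p q r s)).
  rewrite /Q (_ : (fun t => _) = fun t => sum4 (fun p q r s =>
    A p q * A r s * (V t p * V t q * V t r * V t s))); last first.
    by apply/funext => t; exact: sqr_quad_formE.
  by apply: has_mean_sum4 => p q r s; exact: has_meanZ.
apply: (le_trans (variance_le_sqr_mean P _ _ mQ Q2)); rewrite lee_fin.
apply: (@le_trans _ _ (3 ^+ k * sum4 (fun p q r s => a p * a q * a r * a s *
    \prod_i pairings (digit p i) (digit q i) (digit r i) (digit s i)))).
  rewrite mulr_sum4; apply: ler_sum4 => p q r s.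
  have /andP[M0 Mle] := M_bounds p q r s.
  (* Entries of [A] may be negative; since [M p q r s] is nonnegative, A_pq A_rs can still be
     replaced by an upper bound of its absolute value. *)
  apply: (@le_trans _ _ (a p * a q * a r * a s * M p q r s)).
    rewrite ler_wpM2r// (le_trans (ler_norm _))// normrM -[leRHS]mulrA.
    by rewrite ler_pM.
  rewrite mulrCA ler_wpM2l ?mulr_ge0//.
  by move: Mle; rewrite big_split/= prodr_const card_ord.
(* The outer 3^k was spent on the moment bounds; the inner one pays for the pairings, with all four
   vectors equal to [a]. *)
apply: (@le_trans _ _ (3 ^+ k * (3 ^+ k * (l2norm a * l2norm a * l2norm a * l2norm a)))).
  by rewrite ler_wpM2l ?exprn_ge0// sum4_digit_pairings_le.
have trE : l2norm a ^+ 2 = \tr A.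
  by rewrite sqr_l2norm; apply: eq_bigr => p _; rewrite sqr_sqrtr.
rewrite -trE le_eqVlt; apply/orP; left; apply/eqP; ring.
Qed.
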